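(* Let $(X,\mathcal{A})$ be a measurable space, let $\mu\colon\mathcal{A}\to[0,\infty]$ be a nonadditive measure, and let $0<p<\infty$ and $0<q<\infty$. Assume that $\mu$ is conditionally order continuous and relaxed subadditive. Assume that $\mu$ has a countable basis of sets in $\mathcal{A}$ with finite $\mu$-measure. Then there is a countable subset $\mathcal{E}$ of $\mathcal{L}^{p,q}(\mu)$ such that for any $f\in\mathcal{L}^{p,q}(\mu)$ and $\varepsilon>0$ there is a $\psi\in\mathcal{E}$ such that $\|f-\psi\|_{p,q}<\varepsilon$. Hence $\mathcal{L}^{p,q}(\mu)$ is separable. If $\mu$ is additionally assumed to be null-additive, then $L^{p,q}(\mu)$ is separable.
   Context: $X$ is a nonempty set and $\mathcal{A}$ is a $\sigma$-field of subsets of $X$. A nonadditive measure is a set function $\mu\colon\mathcal{A}\to[0,\infty]$ with $\mu(\emptyset)=0$ and $\mu(A)\le\mu(B)$ whenever $A,B\in\mathcal{A}$, $A\subset B$. $\mathcal{F}_0(X)$ is the real linear space of all $\mathcal{A}$-measurable functions $X\to\mathbb{R}$. Conditionally order continuous: $\mu(A_n)\to 0$ whenever $\{A_n\}_{n\in\mathbb{N}}\subset\mathcal{A}$ is nonincreasing with $\bigcap_{n=1}^\infty A_n=\emptyset$ and $\mu(A_1)<\infty$. Relaxed subadditive: there is a constant $K\ge 1$ such that $\mu(A\cup B)\le K\{\mu(A)+\mu(B)\}$ for every disjoint $A,B\in\mathcal{A}$. Null-additive: $\mu(A\cup B)=\mu(A)$ whenever $A,B\in\mathcal{A}$ and $\mu(B)=0$.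 $\mu$ has a countable basis of sets in $\mathcal{A}$ with finite $\mu$-measure: there is a countable collection $\mathcal{D}\subset\mathcal{A}$ of sets of finite $\mu$-measure such that for any $\varepsilon>0$ and any $A\in\mathcal{A}$ with $\mu(A)<\infty$ there is $D\in\mathcal{D}$ with $\mu(A\triangle D)<\varepsilon$, where $A\triangle D=(A\setminus D)\cup(D\setminus A)$. Choquet integral: $\mathrm{Ch}(\nu,g):=\int_0^\infty\nu(\{g>t\})\,dt\in[0,\infty]$ for a nonadditive measure $\nu$ and measurable $g\colon X\to[0,\infty)$. With $\mu^{q/p}(A):=\mu(A)^{q/p}$, define for $f\in\mathcal{F}_0(X)$ $$\|f\|_{p,q}:=\left(\frac{p}{q}\right)^{1/q}\mathrm{Ch}(\mu^{q/p},|f|^q)^{1/q}\in[0,\infty],$$ and $\mathcal{L}^{p,q}(\mu):=\{f\in\mathcal{F}_0(X):\|f\|_{p,q}<\infty\}$. For $\mu$ null-additive, $f\sim g$ iff $\mu(\{|f-g|>c\})=0$ for every $c>0$ is an equivalence relation on $\mathcal{F}_0(X)$; $[f]$ is the class of $f$, with $[f]+[g]:=[f+g]$, $c[f]:=[cf]$; $L^{p,q}(\mu):=\{[f]: f\in\mathcal{L}^{p,q}(\mu)\}$ and $\|[f]\|_{p,q}:=\|f\|_{p,q}$ (well-defined when $\mu$ is null-additive). A space $V$ of this kind is separable if it has a countable subset $D$ such that for any $x\in V$ and $\varepsilon>0$ there is $y\in D$ with $\|x-y\|_{p,q}<\varepsilon$. *)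

(* Defs.v *)
From HB Require Import structures.
From mathcomp Require Import all_boot all_order all_algebra.
From mathcomp Require Import generic_quotient.
From mathcomp Require Import all_classical all_reals all_analysis.
From mathcomp Require Import measurable_realfun.

Set Implicit Arguments.
Unset Strict Implicit.
Unset Printing Implicit Defensive.
Import Order.TTheory GRing.Theory Num.Theory.
Import numFieldNormedType.Exports.
Local Open Scope classical_set_scope.
Local Open Scope ring_scope.

(* The values of [mu] outside the sigma-field are unconstrained: every
   definition below evaluates [mu] on measurable sets only. *)
Record nonadditive_measure (d : measure_display) (T : measurableType d)
    (R : realType) := NonadditiveMeasure {
  nonadditive_fun :> set T -> \bar R ;
  nonadditive0 : nonadditive_fun set0 = 0%E ;
  nonadditive_ge0 : forall A, measurable A -> (0 <= nonadditive_fun A)%E ;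
  nonadditive_le : forall A B, measurable A -> measurable B -> A `<=` B ->
    (nonadditive_fun A <= nonadditive_fun B)%E }.

Section properties.
Context (d : measure_display) (T : measurableType d) (R : realType).
Implicit Type mu : nonadditive_measure T R.
Local Open Scope ereal_scope.

Definition conditionally_order_continuous mu :=
  forall A : (set T)^nat, (forall n, measurable (A n)) -> nonincreasing_seq A ->
    \bigcap_n A n = set0 -> mu (A 0%N) < +oo -> mu \o A @ \oo --> 0.

Definition relaxed_subadditive mu :=
  exists2 K : R, (1 <= K)%R & forall A B, measurable A -> measurable B ->
    A `&` B = set0 -> mu (A `|` B) <= K%:E * (mu A + mu B).

Definition null_additive mu :=
  forall A B, measurable A -> measurable B -> mu B = 0 -> mu (A `|` B) = mu A.

Definition has_countable_basis mu :=
  exists D : set (set T), [/\ countable D,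
    forall B, D B -> measurable B /\ mu B < +oo &
    forall (e : R) A, (0 < e)%R -> measurable A -> mu A < +oo ->
      exists2 B, D B & mu (A `+` B) < e%:E].

End properties.

Section Lorentz.
Context (d : measure_display) (T : measurableType d) (R : realType).
Local Open Scope ereal_scope.

Definition Choquet (nu : set T -> \bar R) (g : T -> R) : \bar R :=
  \int[lebesgue_measure]_(t in `[0%R, +oo[) nu [set x | (t < g x)%R].

Context (mu : nonadditive_measure T R) (p q : R).

Definition Lorentz_norm (f : {mfun T >-> R}) : \bar R :=
  ((p / q) `^ q^-1)%:E *
  (Choquet (fun A => mu A `^ (q / p)) (fun x => (`|f x| `^ q)%R)) `^ q^-1.

Definition Lorentz : set {mfun T >-> R} := [set f | Lorentz_norm f < +oo].

End Lorentz.

Definition separable (R : realType) (U : zmodType) (N : U -> \bar R)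
    (V : set U) :=
  exists D : set U, [/\ countable D, D `<=` V &
    forall x (e : R), V x -> 0 < e ->
      exists2 y, D y & (N (x - y)%R < e%:E)%E].

Section measurable_lemmas.
Context (d : measure_display) (T : measurableType d) (R : realType).
Implicit Types f g : {mfun T >-> R}.

Lemma measurable_gt_dist f g (c : R) :
  measurable [set x | c < `|f x - g x|].
Proof.
have mh : measurable_fun setT (fun x => `|f x - g x|).
  by apply: measurableT_comp => //; exact: measurable_funB.
rewrite [X in measurable X](_ : _ = (fun x => `|f x - g x|) @^-1` `]c, +oo[).
  by rewrite -[X in measurable X]setTI; exact: mh.
by apply/seteqP; split => x /=; rewrite in_itv/= andbT.
Qed.

Lemma measurable_gt_powR f (q c : R) :
  measurable [set x | c < `|f x| `^ q].
Proof.
have mh : measurable_fun setT (fun x => `|f x| `^ q).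
  apply: (measurableT_comp (measurable_powR q)).
  exact: measurableT_comp.
rewrite [X in measurable X](_ : _ = (fun x => `|f x| `^ q) @^-1` `]c, +oo[).
  by rewrite -[X in measurable X]setTI; exact: mh.
by apply/seteqP; split => x /=; rewrite in_itv/= andbT.
Qed.

End measurable_lemmas.

Section equivalence.
Context (d : measure_display) (T : measurableType d) (R : realType)
  (mu : nonadditive_measure T R).
Implicit Types f g h : {mfun T >-> R}.

Definition null_eq f g : bool :=
  `[< forall c : R, 0 < c -> mu [set x | c < `|f x - g x|] = 0%E >].

Lemma nonadditive_null A B : measurable A -> measurable B -> A `<=` B ->
  mu B = 0%E -> mu A = 0%E.
Proof.
move=> mA mB AB B0; apply/eqP; rewrite eq_le -{1}B0 nonadditive_le//=.
exact: nonadditive_ge0.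
Qed.

Lemma null_eq_refl : reflexive null_eq.
Proof.
move=> f; apply/asboolP => c c0.
rewrite (_ : [set x | _] = set0) ?nonadditive0//.
by apply/seteqP; split => x //=; rewrite subrr normr0 ltNge ltW.
Qed.

Lemma null_eq_sym : symmetric null_eq.
Proof.
move=> f g; apply/idP/idP => /asboolP h; apply/asboolP => c c0.
  by under eq_set do rewrite distrC; exact: h.
by under eq_set do rewrite distrC; exact: h.
Qed.

Hypothesis hmu : null_additive mu.

Lemma null_eqD f f' g g' :
  null_eq f f' -> null_eq g g' -> null_eq (f + g) (f' + g').
Proof.
move=> /asboolP ff' /asboolP gg'; apply/asboolP => c c0.
have c20 : 0 < c / 2 by rewrite divr_gt0.
have mf := measurable_gt_dist f f' (c / 2).
have mg := measurable_gt_dist g g' (c / 2).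
apply: (@nonadditive_null _ ([set x | c / 2 < `|f x - f' x|] `|`
    [set x | c / 2 < `|g x - g' x|])).
- exact: measurable_gt_dist.
- exact: measurableU.
- move=> x /= cx; apply/orP; move: cx; apply: contraTT.
  rewrite negb_or -!leNgt => /andP[fx gx].
  rewrite opprD addrACA (le_trans (ler_normD _ _))//.
  by rewrite (splitr c) lerD.
- by rewrite hmu ?gg' ?ff'.
Qed.

Lemma null_eq_trans : transitive null_eq.
Proof.
move=> g f h fg gh.
have := null_eqD (null_eqD fg gh) (null_eq_refl (- g)).
by rewrite addrK [g + h]addrC addrK.
Qed.

End equivalence.

Section quotient.
Context (d : measure_display) (T : measurableType d) (R : realType)
  (mu : nonadditive_measure T R) (hmu : null_additive mu).
Local Open Scope quotient_scope.

Definition null_eq_equiv : equiv_rel {mfun T >-> R} :=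
  EquivRel (null_eq mu) (null_eq_refl mu) (null_eq_sym mu)
    (null_eq_trans hmu).

Definition L0 : Type := {eq_quot null_eq_equiv}.
HB.instance Definition _ := Choice.on L0.
HB.instance Definition _ := EqQuotient.on L0.

Definition L0_class (f : {mfun T >-> R}) : L0 := \pi_L0 f.

Lemma L0_classP f g : L0_class f = L0_class g <->
  forall c : R, 0 < c -> mu [set x | c < `|f x - g x|] = 0%E.
Proof.
split=> [/eqquotP /asboolP//|fg]; apply/eqquotP; exact/asboolP.
Qed.

Definition L0_add (u v : L0) : L0 := L0_class (repr u + repr v).
Definition L0_scale (c : R) (u : L0) : L0 := L0_class (c *: repr u).

Lemma L0_reprK u : L0_class (repr u) = u.
Proof. exact: reprK. Qed.

Lemma null_eq_repr f : null_eq mu (repr (L0_class f)) f.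
Proof. by apply/(eqquotP (e := null_eq_equiv) L0); rewrite reprK. Qed.

Lemma L0_class_eq f g : null_eq mu f g -> L0_class f = L0_class g.
Proof. by move=> fg; apply/(eqquotP (e := null_eq_equiv) L0). Qed.

Lemma null_eqZ c f g : null_eq mu f g -> null_eq mu (c *: f) (c *: g).
Proof.
move=> /asboolP fg; apply/asboolP => e e0.
have [->|c0] := eqVneq c 0.
  by rewrite !scale0r; move/asboolP: (null_eq_refl mu 0); exact.
have -> : [set x | e < `|(c *: f) x - (c *: g) x|] =
          [set x | e / `|c| < `|f x - g x|].
  apply/seteqP; split => x /=;
    by rewrite -scalerBr normrM ltr_pdivrMr ?normr_gt0// mulrC.
by rewrite fg// divr_gt0// normr_gt0.
Qed.

Lemma L0_addE f g : L0_add (L0_class f) (L0_class g) = L0_class (f + g).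
Proof. by apply/L0_class_eq/null_eqD => //; exact: null_eq_repr. Qed.

Lemma L0_scaleE c f : L0_scale c (L0_class f) = L0_class (c *: f).
Proof. by apply/L0_class_eq/null_eqZ; exact: null_eq_repr. Qed.

Definition L0_zero : L0 := L0_class 0.
Definition L0_opp (u : L0) : L0 := L0_scale (-1) u.

Lemma L0_addA : associative L0_add.
Proof.
move=> u v w; rewrite -(L0_reprK u) -(L0_reprK v) -(L0_reprK w).
by rewrite !L0_addE addrA.
Qed.

Lemma L0_addC : commutative L0_add.
Proof. by move=> u v; rewrite /L0_add addrC. Qed.

Lemma L0_add0 : left_id L0_zero L0_add.
Proof. by move=> u; rewrite -(L0_reprK u) L0_addE add0r. Qed.

Lemma L0_addN : left_inverse L0_zero L0_opp L0_add.
Proof.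
by move=> u; rewrite -(L0_reprK u) /L0_opp L0_scaleE L0_addE scaleN1r addNr.
Qed.

HB.instance Definition _ :=
  GRing.isZmodule.Build L0 L0_addA L0_addC L0_add0 L0_addN.

Lemma L0_scaleA a b u : L0_scale a (L0_scale b u) = L0_scale (a * b) u.
Proof. by rewrite -(L0_reprK u) !L0_scaleE scalerA. Qed.

Lemma L0_scale1 : left_id 1 L0_scale.
Proof. by move=> u; rewrite -(L0_reprK u) L0_scaleE scale1r. Qed.

Lemma L0_scaleDr : right_distributive L0_scale +%R.
Proof.
move=> c u v; rewrite -(L0_reprK u) -(L0_reprK v).
by rewrite /GRing.add/= !(L0_addE, L0_scaleE) scalerDr.
Qed.

Lemma L0_scaleDl u : {morph L0_scale^~ u : a b / a + b}.
Proof.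
move=> a b; rewrite -(L0_reprK u).
by rewrite [RHS]/GRing.add/= !(L0_addE, L0_scaleE) scalerDl.
Qed.

HB.instance Definition _ := GRing.Zmodule_isLmodule.Build R L0
  L0_scaleA L0_scale1 L0_scaleDr L0_scaleDl.

Lemma L0_classD f g : L0_class f + L0_class g = L0_class (f + g).
Proof. exact: L0_addE. Qed.

Lemma L0_classZ c f : c *: L0_class f = L0_class (c *: f).
Proof. exact: L0_scaleE. Qed.

End quotient.

Section class_norm.
Context (d : measure_display) (T : measurableType d) (R : realType)
  (mu : nonadditive_measure T R) (hmu : null_additive mu) (p q : R).

Definition L0_norm (u : L0 hmu) : \bar R := Lorentz_norm mu p q (repr u).

Definition Lorentz_quotient : set (L0 hmu) :=
  [set L0_class hmu f | f in Lorentz mu p q].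

End class_norm.
Arguments L0_norm {d T R mu} hmu p q u.
Arguments Lorentz_quotient {d T R mu} hmu p q _.

(* [L0_norm] is computed on a chosen representative; the rest of this file
   proves that the choice is irrelevant, see [L0_norm_class]. *)
Section antitone.
Context (R : realType).
Implicit Types F G : R -> \bar R.

Lemma antitone_measurable F (D : set R) :
  {homo F : s t / s <= t >-> (t <= s)%E} -> measurable D -> measurable_fun D F.
Proof.
move=> hF mD; apply: (measurability _ (ErealGenOInfty.measurableE R)).
move=> _ [_ [r ->]] <-; apply: measurableI => //.
apply: is_interval_measurable => s t /=; rewrite !in_itv/= !andbT.
move=> _ ft u /andP[_ ut]; rewrite in_itv/= andbT.
exact: lt_le_trans ft (hF _ _ ut).
Qed.

Lemma countable_antitone_gap F G : (forall s t, s < t -> (F t <= G s)%E) ->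
  countable [set s | (G s < F s)%E].
Proof.
move=> FG.
have /choice[r rP] : forall s, exists r : rat, (G s < F s)%E ->
    contract (G s) < ratr r < contract (F s).
  move=> s; have [GF|] := pselect (G s < F s)%E; last by exists 0.
  have : contract (G s) < contract (F s) by rewrite lt_contract.
  by move=> /rat_in_itvoo[r]; rewrite in_itv/= => rs; exists r.
apply/countable_injP; exists (pickle \o r) => s t; rewrite !inE/= => ss tt.
move=> /(pcan_inj pickleK) rst.
have lt u v : (G u < F u)%E -> (G v < F v)%E -> u < v -> r u <> r v.
  move=> uu vv uv ruv.
  have /andP[Gr _] := rP _ uu; have /andP[_ rF] := rP _ vv.
  move: Gr; rewrite ruv => /lt_trans /(_ rF).
  by rewrite lt_contract ltNge FG.
have [st|ts|//] := ltgtP s t; first by case: (lt _ _ ss tt st).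
by case: (lt _ _ tt ss ts).
Qed.

Lemma integral_antitone_eq F G (D : set R) : measurable D ->
  {homo F : s t / s <= t >-> (t <= s)%E} ->
  {homo G : s t / s <= t >-> (t <= s)%E} ->
  (forall s, 0 <= F s)%E -> (forall s, 0 <= G s)%E ->
  (forall s t, s < t -> (F t <= G s)%E) ->
  (forall s t, s < t -> (G t <= F s)%E) ->
  (\int[lebesgue_measure]_(t in D) F t =
   \int[lebesgue_measure]_(t in D) G t)%E.
Proof.
move=> mD hF hG F0 G0 FG GF; apply: ge0_ae_eq_integral => //.
- exact: antitone_measurable.
- exact: antitone_measurable.
have cN : countable ([set s | (G s < F s)%E] `|` [set s | (F s < G s)%E]).
  rewrite -bigcup2E; apply: bigcup_countable => // -[|[|i]] _ //=;
    exact: countable_antitone_gap.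
exists ([set s | (G s < F s)%E] `|` [set s | (F s < G s)%E]); split.
- by apply: countable_measurable => // t; exact: measurable_set1.
- exact: countable_lebesgue_measure0.
by move=> s /= /not_implyP[_ /eqP]; rewrite neq_lt => /orP[]; [right|left].
Qed.

End antitone.

Section norm_well_defined.
Context (d : measure_display) (T : measurableType d) (R : realType)
  (mu : nonadditive_measure T R) (hmu : null_additive mu) (p q : R).
Hypotheses (p0 : 0 < p) (q0 : 0 < q).
Implicit Types f g : {mfun T >-> R}.

Let dist f (t : R) : \bar R := (mu [set x | (t < `|f x| `^ q)%R] `^ (q / p))%E.

Let le_pow A B : measurable A -> measurable B -> (mu A <= mu B)%E ->
  (mu A `^ (q / p) <= mu B `^ (q / p))%E.
Proof.
move=> mA mB AB; apply: gt0_ler_poweR => //.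
- by rewrite ltW// divr_gt0.
- by rewrite in_itv/= nonadditive_ge0// leey.
- by rewrite in_itv/= nonadditive_ge0// leey.
Qed.

Let dist_homo f : {homo dist f : s t / s <= t >-> (t <= s)%E}.
Proof.
move=> s t st; apply: le_pow; [exact: measurable_gt_powR..|].
apply: nonadditive_le; [exact: measurable_gt_powR..|].
by move=> x /=; exact: le_lt_trans.
Qed.

Let dist_le f g s t : null_eq mu f g -> s < t -> (dist f t <= dist g s)%E.
Proof.
move=> /asboolP fg st; apply: le_pow; [exact: measurable_gt_powR..|].
have [s0|s0] := ltP s 0.
  apply: nonadditive_le; [exact: measurable_gt_powR..|].
  by move=> x _ /=; rewrite (lt_le_trans s0)// powR_ge0.
have t0 : 0 < t := le_lt_trans s0 st.
set c := t `^ q^-1 - s `^ q^-1.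
have qV0 : 0 < q^-1 by rewrite invr_gt0.
have c0 : 0 < c.
  by rewrite subr_gt0 gt0_ltr_powR// nnegrE// ltW.
have mg := measurable_gt_powR g q s.
have mfg := measurable_gt_dist f g c.
rewrite -(hmu mg mfg (fg _ c0)).
apply: nonadditive_le => //; [exact: measurable_gt_powR|exact: measurableU|].
move=> x /= tx; apply/orP; move: tx; apply: contraTT.
rewrite negb_or -!leNgt => /andP[gx fgx].
have powK (y : R) : 0 <= y -> (y `^ q) `^ q^-1 = y.
  by move=> y0; rewrite -powRrM divff ?gt_eqF// powRr1.
have powVK (y : R) : 0 <= y -> (y `^ q^-1) `^ q = y.
  by move=> y0; rewrite -powRrM mulVf ?gt_eqF// powRr1.
rewrite -[leRHS]powVK ?(ltW t0)//.
apply: ge0_ler_powR; rewrite ?nnegrE ?powR_ge0 ?(ltW q0)//.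
have gs : `|g x| <= s `^ q^-1.
  rewrite -[leLHS]powK//.
  by apply: ge0_ler_powR; rewrite ?nnegrE ?powR_ge0// ltW.
rewrite -(subrK (g x) (f x)) (le_trans (ler_normD _ _))//.
by rewrite -(subrK (s `^ q^-1) (t `^ q^-1)) lerD.
Qed.

Lemma Lorentz_norm_null_eq f g : null_eq mu f g ->
  Lorentz_norm mu p q f = Lorentz_norm mu p q g.
Proof.
move=> fg; rewrite /Lorentz_norm.
suff -> : Choquet (fun A => mu A `^ (q / p))%E (fun x => `|f x| `^ q) =
    Choquet (fun A => mu A `^ (q / p))%E (fun x => `|g x| `^ q) by [].
have gf : null_eq mu g f by rewrite null_eq_sym.
apply: (integral_antitone_eq (F := dist f) (G := dist g)) => //.
- by move=> s; exact: poweR_ge0.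
- by move=> s; exact: poweR_ge0.
- by move=> s t; exact: dist_le.
- by move=> s t; exact: dist_le.
Qed.

Lemma L0_norm_class f : L0_norm hmu p q (L0_class hmu f) = Lorentz_norm mu p q f.
Proof. exact/Lorentz_norm_null_eq/null_eq_repr. Qed.

End norm_well_defined.

(* Main.v *)
(* The Choquet integral [J f] of [|f|^q] with respect to [mu^(q/p)] is
   quasi-subadditive, since [mu] is relaxed subadditive, so the functions
   approximable by rational combinations of indicators of basis sets form a
   class closed under addition and under [J]-limits.  It contains [r 1_A] for
   [r] rational and [mu A] finite: [r 1_A - r 1_D] is bounded and supported in
   the symmetric difference of [A] and [D], so its energy is at most
   [|r|^q] times the [q/p]-th power of its measure.  Finally [f] is the
   [J]-limit of sums of rational multiples of indicators of its superlevel sets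
   and those of [-f], by dominated convergence in the variable [t] of the
   Choquet integral; the integrand tends to [0] at each [t > 0] because
   conditional order continuity gives [mu {|f| > n} --> 0]. *)
Require Import Defs.
From mathcomp Require Import all_boot all_order all_algebra.
From mathcomp Require Import all_classical all_reals all_analysis.
From mathcomp Require Import measurable_realfun.

Set Implicit Arguments.
Unset Strict Implicit.
Unset Printing Implicit Defensive.
Import Order.TTheory GRing.Theory Num.Theory.
Import numFieldNormedType.Exports.

Local Open Scope classical_set_scope.
Local Open Scope ring_scope.

(** * Powers of nonnegative extended reals *)

Section extended_powers.
Context (R : realType).
Local Open Scope ereal_scope.
Implicit Types (a b : \bar R) (r : R).

Lemma ge0_le_poweR r a b : (0 <= r)%R -> 0 <= a -> a <= b ->
  a `^ r <= b `^ r.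
Proof.
move=> r0 a0 ab; apply: gt0_ler_poweR => //; rewrite in_itv/= leey andbT//.
exact: le_trans ab.
Qed.

(** The sum is at most twice its larger term. This crude constant serves every exponent [r >= 0],
    with no case split at [r = 1]. *)
Lemma poweRD_le r a b : (0 <= r)%R -> 0 <= a -> 0 <= b ->
  (a + b) `^ r <= (2 `^ r)%:E * (a `^ r + b `^ r).
Proof.
move=> r0; wlog ab : a b / a <= b => [th a0 b0|a0 b0].
  have [ab|/ltW ba] := leP a b; first exact: th.
  by rewrite addeC [X in _ * X]addeC; exact: th.
have ab2 : a + b <= 2%:E * b by rewrite mule_natl mule2n leeD2r.
rewrite (le_trans (ge0_le_poweR r0 _ ab2)) ?adde_ge0//.
rewrite poweRM// poweR_EFin lee_wpmul2l// ?lee_fin ?powR_ge0//.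
by rewrite leeDr// poweR_ge0.
Qed.

Lemma cvg_poweR0 (u : (\bar R)^nat) r : (0 < r)%R -> (forall n, 0 <= u n) ->
  u @ \oo --> 0 -> (u n `^ r) @[n --> \oo] --> 0.
Proof.
move=> r0 u0 /fine_cvgP[ufin ucvg]; apply/fine_cvgP; split.
  by apply: filterS ufin => n; exact: fin_num_poweR.
rewrite (_ : fine \o _ = (fun n => (fine (u n) `^ r)%R)); last first.
  by apply/funext => n /=; rewrite fine_poweR.
apply/cvgrPdist_lt => e e0.
(* The tolerance for [u] is the [r]-th root of [e], whose [r]-th power is [e] again. *)
have e'0 : (0 < e `^ r^-1)%R by rewrite powR_gt0.
move/cvgrPdist_lt : ucvg => /(_ _ e'0); apply: filterS => n /=.
rewrite !sub0r !normrN !ger0_norm ?powR_ge0 ?fine_ge0// => ue.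
rewrite -[ltRHS]powRr1 ?ltW// -(mulVf (lt0r_neq0 r0)) powRrM.
by rewrite gt0_ltr_powR// nnegrE ?fine_ge0// powR_ge0.
Qed.

End extended_powers.

(** * Scaling of Lebesgue integrals over the half-line *)

Section lebesgue_dilation.
Context (R : realType).
Local Open Scope ereal_scope.
Local Notation leb := (@lebesgue_measure R).

(** Lebesgue measure is [1 / c] times its image under [phi]. By uniqueness this need only be checked
    on half-open intervals. *)
Lemma ge0_integral_dilation (c : R) (F : R -> \bar R) : (0 < c)%R ->
  measurable_fun setT F -> (forall t, 0 <= F t) ->
  \int[leb]_(t in `[0%R, +oo[) F (t / c)%R =
  c%:E * \int[leb]_(t in `[0%R, +oo[) F t.
Proof.
move=> c0 mF F0.
pose phi : measurableTypeR R -> measurableTypeR R := fun t => (t / c)%R.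
have mphi : measurable_fun setT phi by exact: measurable_funM.
have cV0 : (0 <= c^-1)%R by rewrite invr_ge0 ltW.
have lebE A : measurable A ->
    leb A = mscale (NngNum cV0) (pushforward leb phi) A.
  apply: lebesgue_measure_unique => _ [[a b]] _ <- /=.
  rewrite /mscale/= /pushforward.
  have -> : phi @^-1` `]a, b]%classic = `](a * c)%R, (b * c)%R]%classic.
    by apply/seteqP; split => t /=;
      rewrite !in_itv/= /phi ltr_pdivlMr// ler_pdivrMr.
  rewrite !lebesgue_measure_itv/= !lte_fin ltr_pM2r//.
  case: ifPn => _; last by rewrite mule0.
  by rewrite -!EFinB -EFinM -mulrBl mulrC mulfK// gt_eqF.
rewrite [in RHS](eq_measure_integral
    (mscale (NngNum cV0) (pushforward leb phi))) => [|A mA _]; last exact: lebE.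
rewrite ge0_integral_mscale//=; last exact: measurable_funTS.
rewrite ge0_integral_pushforward//; last exact: measurable_funTS.
rewrite muleA -EFinM divff ?gt_eqF// mul1e; congr (integral _ _ _).
apply/seteqP; split => t /=; rewrite !in_itv/= !andbT /phi.
  by move=> t0; rewrite divr_ge0// ltW.
by rewrite pmulr_lge0// invr_gt0.
Qed.

End lebesgue_dilation.

(** * The Choquet energy and its basic estimates *)

Section Lorentz_functional.
Context (d : measure_display) (T : measurableType d) (R : realType).
Context (mu : nonadditive_measure T R) (p q : R).
Context (p0 : 0 < p) (q0 : 0 < q).
Implicit Types f g : {mfun T >-> R}.
Local Open Scope ereal_scope.

Let qp0 : (0 < q / p)%R. Proof. exact: divr_gt0. Qed.

Definition distribution_pow f (t : R) : \bar R :=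
  mu [set x | (t < `|f x| `^ q)%R] `^ (q / p).

Definition Lorentz_energy f : \bar R :=
  Choquet (fun A => mu A `^ (q / p)) (fun x => `|f x| `^ q)%R.

Lemma distribution_pow_ge0 f t : 0 <= distribution_pow f t.
Proof. exact: poweR_ge0. Qed.

Lemma mu_pow_le A B : measurable A -> measurable B -> A `<=` B ->
  mu A `^ (q / p) <= mu B `^ (q / p).
Proof.
move=> mA mB AB; apply: ge0_le_poweR; rewrite ?(ltW qp0)//.
  exact: nonadditive_ge0.
exact: nonadditive_le.
Qed.

Lemma distribution_pow_homo f :
  {homo distribution_pow f : s t / (s <= t)%R >-> t <= s}.
Proof.
move=> s t st; apply: mu_pow_le; [exact: measurable_gt_powR..|].
by move=> x /=; exact: le_lt_trans.
Qed.

Lemma measurable_distribution_pow f D :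
  measurable D -> measurable_fun D (distribution_pow f).
Proof.
by move=> mD; apply: antitone_measurable => //; exact: distribution_pow_homo.
Qed.

Lemma Lorentz_energyE f :
  Lorentz_energy f =
  \int[lebesgue_measure]_(t in `[0%R, +oo[) distribution_pow f t.
Proof. by []. Qed.

Lemma Lorentz_energy_ge0 f : 0 <= Lorentz_energy f.
Proof. by apply: integral_ge0 => t _; exact: distribution_pow_ge0. Qed.

Lemma Lorentz_normE f :
  Lorentz_norm mu p q f = ((p / q) `^ q^-1)%:E * Lorentz_energy f `^ q^-1.
Proof. by []. Qed.

Lemma LorentzP f : Lorentz mu p q f <-> Lorentz_energy f < +oo.
Proof.
rewrite /Lorentz/= Lorentz_normE.
have c0 : (0 < (p / q) `^ q^-1)%R by rewrite powR_gt0// divr_gt0.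
have qV0 : (q^-1 != 0)%R by rewrite invr_eq0 gt_eqF.
split=> [h|h].
  apply: (@lty_poweRy _ _ q^-1) => //; rewrite ltey; apply/eqP => Jy.
  by move: h; rewrite Jy gt0_muley// lte_fin.
by rewrite lte_mul_pinfty ?lee_fin ?powR_ge0// poweR_lty.
Qed.

Lemma Lorentz_norm_lt (e : R) : (0 < e)%R -> exists2 e' : R, (0 < e')%R &
  forall f, Lorentz_energy f < e'%:E -> Lorentz_norm mu p q f < e%:E.
Proof.
move=> e0; have c0 : (0 < (p / q) `^ q^-1)%R by rewrite powR_gt0// divr_gt0.
(* This value solves [(p / q)^(1/q) * e'^(1/q) = e]. *)
exists ((e / (p / q) `^ q^-1) `^ q)%R; first by rewrite powR_gt0// divr_gt0.
move=> f; rewrite Lorentz_normE; have := Lorentz_energy_ge0 f.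
case: (Lorentz_energy f) => [x| |] //=; rewrite ?lee_fin ?lte_fin => x0 xe.
rewrite mulrC -ltr_pdivlMr// -[ltRHS]powRr1 ?divr_ge0 ?ltW//.
rewrite -(mulfV (lt0r_neq0 q0)) powRrM.
by rewrite gt0_ltr_powR ?invr_gt0// nnegrE ?powR_ge0.
Qed.

(** The integrand vanishes beyond [b^q], and up to that point it is at most [mu N ^ (q / p)],
    because [f] is zero off [N]. *)
Lemma Lorentz_energy_bounded f N (b : R) : measurable N -> (0 <= b)%R ->
  (forall x, `|f x| <= b)%R -> (forall x, ~ N x -> f x = 0%R) ->
  Lorentz_energy f <= (b `^ q)%:E * mu N `^ (q / p).
Proof.
move=> mN b0 fb fN.
have out t : t \in `[0%R, +oo[%classic ->
    distribution_pow f t = (distribution_pow f \_ `[0%R, (b `^ q)%R]) t.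
  rewrite inE/= in_itv/= andbT => t0; rewrite patchE; case: ifPn => // tb.
  rewrite /distribution_pow (_ : [set x | _] = set0).
    by rewrite nonadditive0 poweR0r// gt_eqF.
  apply/seteqP; split => x //=.
  apply/negP; rewrite -leNgt.
  move/negP : tb; rewrite inE/= in_itv/= t0/= => /negP; rewrite -ltNge => bt.
  by rewrite (le_trans _ (ltW bt))// ge0_ler_powR ?nnegrE ?(ltW q0).
have -> : Lorentz_energy f =
    \int[lebesgue_measure]_(t in `[0%R, (b `^ q)%R]) distribution_pow f t.
  rewrite Lorentz_energyE; under eq_integral => t t0 do rewrite out//.
  rewrite -integral_mkcondr; congr (integral _ _ _).
  apply/seteqP; split => t /=; rewrite !in_itv/= ?andbT; first by case.
  by move=> /andP[-> ->].
apply: (@le_trans _ _ (\int[lebesgue_measure]_(t in `[0%R, (b `^ q)%R])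
    (mu N `^ (q / p)))).
  apply: ge0_le_integral => //.
  - by move=> t _; exact: distribution_pow_ge0.
  - exact: measurable_distribution_pow.
  - move=> t /=; rewrite in_itv/= => /andP[t0 _].
    apply: mu_pow_le => //; first exact: measurable_gt_powR.
    move=> x /= tx; apply: contrapT => /fN fx.
    by move: tx; rewrite fx normr0 powR0 ?gt_eqF// ltNge t0.
rewrite integral_cst//= lebesgue_measure_itv/= lte_fin.
(* If [b^q = 0] the interval is a single point, and the convention [0 * +oo = 0] covers an infinite
   [mu N]. *)
have := powR_ge0 b q; rewrite le_eqVlt => /predU1P[<-|->].
  by rewrite ltxx mule0 mul0e.
by rewrite -EFinB subr0 muleC.
Qed.

Lemma Lorentz_energy0 : Lorentz_energy 0%R = 0.
Proof.
apply/eqP; rewrite eq_le Lorentz_energy_ge0 andbT.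
have := @Lorentz_energy_bounded 0%R set0 0 measurable0 (lexx _).
rewrite powR0 ?gt_eqF// mul0e; apply => //.
by move=> x; rewrite normr0.
Qed.

(** Chebyshev's inequality: for [t] in [[0, c^q]] the set [{|f| > c}] lies in [{|f|^q > t}], so the
    integrand is bounded below by a constant there. *)
Lemma Lorentz_energy_chebyshev f (c : R) : (0 <= c)%R ->
  (c `^ q)%:E * mu [set x | c < `|f x|]%R `^ (q / p) <= Lorentz_energy f.
Proof.
move=> c0.
have mc : measurable [set x | c < `|f x|]%R.
  have := measurable_gt_dist f 0%R c.
  by under eq_set do rewrite subr0.
apply: (@le_trans _ _ (\int[lebesgue_measure]_(t in `[0%R, (c `^ q)%R])
    (mu [set x | c < `|f x|]%R `^ (q / p)))).
  rewrite integral_cst//= lebesgue_measure_itv/= lte_fin.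
  have := powR_ge0 c q; rewrite le_eqVlt => /predU1P[<-|->].
    by rewrite ltxx mule0 mul0e.
  by rewrite -EFinB subr0 muleC.
apply: (@le_trans _ _ (\int[lebesgue_measure]_(t in `[0%R, (c `^ q)%R])
    distribution_pow f t)).
  apply: ge0_le_integral => //.
  - by move=> t _; exact: poweR_ge0.
  - exact: measurable_distribution_pow.
  - move=> t /=; rewrite in_itv/= => /andP[_ tc].
    apply: mu_pow_le => //; first exact: measurable_gt_powR.
    move=> x /= cx; rewrite (le_lt_trans tc)// gt0_ltr_powR ?nnegrE//.
apply: ge0_subset_integral => //.
- exact: measurable_distribution_pow.
- by move=> t _; exact: distribution_pow_ge0.
- by move=> t /=; rewrite !in_itv/= andbT => /andP[].
Qed.

(** An infinite measure would make the lower bound of Chebyshev's inequality infinite, since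
    [c^q > 0]. *)
Lemma Lorentz_energy_lty_mu f (c : R) : (0 < c)%R -> Lorentz_energy f < +oo ->
  mu [set x | c < `|f x|]%R < +oo.
Proof.
move=> c0 fy; apply: (@lty_poweRy _ _ (q / p)%R); first by rewrite gt_eqF.
have := le_lt_trans (Lorentz_energy_chebyshev f (ltW c0)) fy.
rewrite ![_ < +oo]ltey; apply: contra => /eqP ->.
by rewrite gt0_muley// lte_fin powR_gt0.
Qed.

(** * Quasi-subadditivity of the energy *)

Section quasi_subadditivity.
Context (K : R) (K1 : (1 <= K)%R)
  (muK : forall A B, measurable A -> measurable B -> A `&` B = set0 ->
    mu (A `|` B) <= K%:E * (mu A + mu B)).

(** Disjointness is dispensed with by splitting the union into [A] and the part of [B] outside
    [A]. *)
Lemma relaxed_muU A B : measurable A -> measurable B ->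
  mu (A `|` B) <= K%:E * (mu A + mu B).
Proof.
move=> mA mB; have mBA : measurable (B `\` A) by exact: measurableD.
rewrite -(setDUK (@subsetUl _ A B)) setDUl setDv set0U.
rewrite (le_trans (muK mA mBA _)) ?setDIK// lee_wpmul2l//.
  by rewrite lee_fin (le_trans _ K1).
by apply: leeD2l; apply: nonadditive_le => //; exact: subDsetl.
Qed.

(** Where [|f + g|^q > t], the larger of [|f|] and [|g|] has [q]-th power above [t / 2^q]. In the
    constant, [K] comes from the measure of a union and [2] from the power of a sum. *)
Lemma distribution_powD f g t : distribution_pow (f + g)%R t <=
  ((K * 2) `^ (q / p))%:E *
  (distribution_pow f (t / 2 `^ q)%R + distribution_pow g (t / 2 `^ q)%R).
Proof.
set A := [set x | (t / 2 `^ q < `|f x| `^ q)%R].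
set B := [set x | (t / 2 `^ q < `|g x| `^ q)%R].
have mA : measurable A by exact: measurable_gt_powR.
have mB : measurable B by exact: measurable_gt_powR.
have K0 : (0 <= K)%R by rewrite (le_trans _ K1).
have ? := nonadditive_ge0 mu mA.
have ? := nonadditive_ge0 mu mB.
apply: (@le_trans _ _ (mu (A `|` B) `^ (q / p))).
  apply: mu_pow_le; [exact: measurable_gt_powR|exact: measurableU|].
  move=> x /= tx; apply/orP; move: tx; apply: contraTT.
  have half (u v : R) : (`|u| <= `|v|)%R -> (`|v| `^ q <= t / 2 `^ q)%R ->
      (`|u + v| `^ q <= t)%R.
    move=> uv; rewrite ler_pdivlMr ?powR_gt0// -powRM//; apply: le_trans.
    rewrite ge0_ler_powR ?nnegrE ?(ltW q0) ?mulr_ge0//.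
    by rewrite (le_trans (ler_normD _ _))// mulr_natr mulr2n lerD2r.
  rewrite negb_or -!leNgt => /andP[fx gx].
  have [fg|/ltW gf] := leP `|f x|%R `|g x|%R; first exact: half.
  by rewrite addrC half.
apply: (@le_trans _ _ ((K%:E * (mu A + mu B)) `^ (q / p))).
  apply: ge0_le_poweR; rewrite ?(ltW qp0)//.
    by apply: nonadditive_ge0; exact: measurableU.
  exact: relaxed_muU.
rewrite poweRM ?adde_ge0// powRM// EFinM -muleA poweR_EFin.
apply: lee_wpmul2l; first by rewrite lee_fin powR_ge0.
by apply: poweRD_le => //; exact: ltW.
Qed.

(** The pointwise bound is integrated in [t]; undoing the dilation by [2^q] contributes the second
    factor of the constant. *)
Lemma Lorentz_energyD f g : Lorentz_energy (f + g)%R <=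
  ((K * 2) `^ (q / p) * 2 `^ q)%:E * (Lorentz_energy f + Lorentz_energy g).
Proof.
have K0 : (0 <= K)%R by rewrite (le_trans _ K1).
have c0 : (0 < (2 : R) `^ q)%R by rewrite powR_gt0.
have mdil (h : {mfun T >-> R}) : measurable_fun (`[0%R, +oo[ : set R)
    (fun t => distribution_pow h (t / 2 `^ q)%R).
  apply: antitone_measurable => // s t st; apply: distribution_pow_homo.
  by rewrite ler_pM2r// invr_gt0.
have mdist (h : {mfun T >-> R}) : measurable_fun setT (distribution_pow h).
  exact: measurable_distribution_pow.
pose D h (t : R) := distribution_pow h (t / 2 `^ q)%R.
have D0 h t : 0 <= D h t by exact: distribution_pow_ge0.
have dilE h : (2 `^ q)%:E * Lorentz_energy h =
    \int[lebesgue_measure]_(t in `[0%R, +oo[) D h t.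
  rewrite ge0_integral_dilation// => t; exact: distribution_pow_ge0.
have mDD : measurable_fun (`[0%R, +oo[ : set R) (fun t => D f t + D g t).
  by apply: emeasurable_funD; exact: mdil.
have : Lorentz_energy (f + g)%R <= ((K * 2) `^ (q / p))%:E *
    (\int[lebesgue_measure]_(t in `[0%R, +oo[) D f t +
     \int[lebesgue_measure]_(t in `[0%R, +oo[) D g t).
  rewrite -ge0_integralD//; [|exact: mdil..].
  rewrite -ge0_integralZl//; last 2 first.
  - by move=> t _; rewrite adde_ge0.
  - by rewrite lee_fin powR_ge0.
  apply: ge0_le_integral => //.
  - by move=> t _; exact: distribution_pow_ge0.
  - exact: measurable_distribution_pow.
  - exact: measurable_funeM.
  - by move=> t _; exact: distribution_powD.
by rewrite -!dilE -ge0_muleDr ?Lorentz_energy_ge0// muleA -EFinM.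
Qed.

End quasi_subadditivity.

End Lorentz_functional.

(** * Small and finite energies under addition *)

Section relaxed_subadditive.
Context (d : measure_display) (T : measurableType d) (R : realType).
Context (mu : nonadditive_measure T R) (p q : R).
Context (p0 : 0 < p) (q0 : 0 < q) (mu_rsub : relaxed_subadditive mu).
Implicit Types f g : {mfun T >-> R}.
Local Notation J := (Lorentz_energy mu p q).
Local Open Scope ereal_scope.

Lemma Lorentz_energy_quasi_subadditive : exists2 C : R, (0 < C)%R &
  forall f g, J (f + g)%R <= C%:E * (J f + J g).
Proof.
have [K K1 muK] := mu_rsub.
exists ((K * 2) `^ (q / p) * 2 `^ q)%R; last exact: Lorentz_energyD.
by rewrite mulr_gt0// powR_gt0// mulr_gt0// (lt_le_trans _ K1).
Qed.

Lemma Lorentz_energyD_lt (e : R) : (0 < e)%R -> exists2 e' : R, (0 < e')%R &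
  forall f g, J f < e'%:E -> J g < e'%:E -> J (f + g)%R < e%:E.
Proof.
move=> e0; have [C C0 JD] := Lorentz_energy_quasi_subadditive.
(* Chosen so that [C * (e' + e') = e]. *)
exists (e / C / 2)%R; first by rewrite !divr_gt0.
move=> f g Jf Jg; apply: le_lt_trans (JD f g) _.
move: (J f) (J g) Jf Jg => a b ae be.
have -> : e%:E = C%:E * ((e / C / 2)%:E + (e / C / 2)%:E).
  by rewrite -EFinD -splitr -EFinM mulrCA divff ?mulr1// gt_eqF.
by rewrite lte_pmul2l// lteD.
Qed.

Lemma Lorentz_energyD_lty f g : J f < +oo -> J g < +oo -> J (f + g)%R < +oo.
Proof.
move=> Jf Jg; have [C C0 JD] := Lorentz_energy_quasi_subadditive.
apply: le_lt_trans (JD f g) _; move: (J f) (J g) Jf Jg => a b ay by_.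
by rewrite lte_mul_pinfty ?lee_fin ?ltW// lte_add_pinfty.
Qed.

End relaxed_subadditive.

(** * Indicators of superlevel sets *)

Section superlevel.
Context (d : measure_display) (T : measurableType d) (R : realType).
Implicit Types f : {mfun T >-> R}.

Lemma measurable_gt f (a : R) : measurable [set x | a < f x].
Proof.
rewrite [X in measurable X](_ : _ = f @^-1` `]a, +oo[).
  by rewrite -[X in measurable X]setTI; exact: measurable_funP.
by apply/seteqP; split => x /=; rewrite in_itv/= andbT.
Qed.

Definition superlevel f (a : R) : {mfun T >-> R} :=
  indic_mfun [set x | a < f x] (measurable_gt f a).

Lemma superlevelE f (a : R) x : superlevel f a x = (a < f x)%R%:R.
Proof.
rewrite /superlevel/= mindicE; congr (nat_of_bool _)%:R.
by apply/idP/idP; rewrite inE.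
Qed.

End superlevel.

(** * Rounding real numbers towards zero *)

Section staircase.
Context (R : realType).
Implicit Types (e y : R) (m : nat).

(* [staircase e m y] rounds [y] towards zero to a multiple of [e], capped at
   [m * e] in absolute value; an exact multiple is rounded one step further. *)
Definition staircase e m y : R :=
  \sum_(k < m) (e * (e *+ k.+1 < y)%R%:R + - e * (e *+ k.+1 < - y)%R%:R).

Lemma staircaseN e m y : staircase e m (- y) = - staircase e m y.
Proof.
rewrite /staircase -sumrN; apply: eq_bigr => k _.
by rewrite opprK !mulNr opprB addrC.
Qed.

(** The first case is the range not yet capped, the second the saturated one. In the induction,
    level [m + 1] adds a step exactly when the sum over the first [m] levels is saturated. *)
Let staircase_ge0 e m y : 0 <= e -> 0 <= y ->
  if y <= e *+ m.+1 then staircase e m y <= y <= staircase e m y + e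
  else staircase e m y == e *+ m.
Proof.
move=> e0 y0; elim: m => [|m IHm].
  by rewrite /staircase !big_ord0 mulr1n add0r; case: ifPn => // ->; rewrite y0.
have -> : staircase e m.+1 y = staircase e m y + e * (e *+ m.+1 < y)%R%:R.
  rewrite /staircase big_ord_recr/=; congr (_ + _).
  (* For [y >= 0] the terms for [- y] are all zero. *)
  have /negbTE-> : ~~ (e *+ m.+1 < - y).
    by rewrite -leNgt (@le_trans _ _ 0) ?oppr_le0 ?mulrn_wge0.
  by rewrite mulr0 addr0.
have le12 : e *+ m.+1 <= e *+ m.+2 by rewrite (mulrS e m.+1) lerDr.
move: IHm; have [ym IHm|ym /eqP ->] := leP y (e *+ m.+1).
  by rewrite mulr0 addr0 (le_trans ym).
by rewrite mulr1 -mulrSr -mulrSr (ltW ym); case: ifP.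
Qed.

(** Capped or not, the rounded value lies between [0] and [y]. This yields the domination needed for
    dominated convergence. *)
Lemma staircase_dist e m y : 0 <= e -> `|y - staircase e m y| <= `|y|.
Proof.
move=> e0; wlog y0 : y / 0 <= y => [th|].
  have [|/ltW yle0] := leP 0 y; first exact: th.
  have := th (- y); rewrite oppr_ge0 staircaseN => /(_ yle0).
  by rewrite -opprD !normrN.
have := @staircase_ge0 e m y e0 y0.
have s0 : 0 <= staircase e m y.
  rewrite /staircase sumr_ge0// => k _; rewrite mulNr subr_ge0.
  rewrite ler_wpM2l// ler_nat; case: (ltP _ (- y)) => // /lt_le_trans.
  move=> /(_ 0); rewrite oppr_le0 => /(_ y0); rewrite ltNge mulrn_wge0//.
have h : staircase e m y <= y -> `|y - staircase e m y| <= `|y|.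
  by move=> sy; rewrite !ger0_norm ?subr_ge0// gerBl.
case: ifPn => [_ /andP[/h//]|]; rewrite -ltNge => ym /eqP sE.
by apply: h; rewrite sE (le_trans _ (ltW ym))// mulrSr lerDl.
Qed.

(** The bound reaches one step beyond the cap [e *+ m], since an error of [e] is allowed. *)
Lemma staircase_near e m y : 0 <= e -> `|y| <= e *+ m.+1 ->
  `|y - staircase e m y| <= e.
Proof.
move=> e0; wlog y0 : y / 0 <= y => [th|].
  have [|/ltW yle0] := leP 0 y; first exact: th.
  have := th (- y); rewrite oppr_ge0 staircaseN => /(_ yle0).
  by rewrite -opprD !normrN.
rewrite (ger0_norm y0) => ym; have := @staircase_ge0 e m y e0 y0.
by rewrite ym => /andP[sy ys]; rewrite ger0_norm ?subr_ge0// lerBlDl.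
Qed.

End staircase.

(** * Convergence of staircases in energy *)

Section staircase_convergence.
Context (d : measure_display) (T : measurableType d) (R : realType).
Context (mu : nonadditive_measure T R) (p q : R).
Context (p0 : 0 < p) (q0 : 0 < q) (mu_coc : conditionally_order_continuous mu).
Implicit Types f g : {mfun T >-> R}.
Local Notation J := (Lorentz_energy mu p q).

(* The step is [1 / (n + 1)] and the cap [n + 1], whence [(n + 1)^2] levels. *)
Definition mfun_staircase f (n : nat) : {mfun T >-> R} :=
  \sum_(k < (n.+1 ^ 2)%N)
    (n.+1%:R^-1 *: superlevel f (n.+1%:R^-1 *+ k.+1) +
     - n.+1%:R^-1 *: superlevel (- f) (n.+1%:R^-1 *+ k.+1)).

Lemma mfun_staircaseE f n x :
  mfun_staircase f n x = staircase n.+1%:R^-1 (n.+1 ^ 2) (f x).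
Proof.
rewrite /mfun_staircase mfun_sum; apply: eq_bigr => k _.
set a := n.+1%:R^-1 *+ k.+1.
transitivity (n.+1%:R^-1 * superlevel f a x +
  - n.+1%:R^-1 * superlevel (- f) a x); first by [].
by rewrite !superlevelE.
Qed.

Lemma sub_mfun_staircaseE f n x : (f - mfun_staircase f n) x =
  f x - staircase n.+1%:R^-1 (n.+1 ^ 2) (f x).
Proof. by rewrite -mfun_staircaseE. Qed.

Local Open Scope ereal_scope.

(** Conditional order continuity applies because the thresholds start at [1] and not at [0]:
    [{|f| > 1}] has finite measure by Chebyshev's inequality, while [{|f| > 0}] may not. *)
Lemma Lorentz_superlevel_cvg0 f : J f < +oo ->
  mu [set x | n.+1%:R < `|f x|]%R @[n --> \oo] --> 0.
Proof.
move=> Jf.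
have mA n : measurable [set x | n.+1%:R < `|f x|]%R.
  have := measurable_gt_dist f 0%R n.+1%:R.
  by under eq_set do rewrite subr0.
apply: (@mu_coc (fun n => [set x | n.+1%:R < `|f x|]%R)) => //.
- move=> m n mn; apply/subsetPset => x /=; apply: le_lt_trans.
  by rewrite ler_nat ltnS.
(* Each [x] already leaves the set indexed by the integer part of [|f x|]. *)
- apply/seteqP; split => x //= /(_ (Num.trunc `|f x|) I)/=.
  by rewrite ltNge (ltW (truncnS_gt _)).
- exact: Lorentz_energy_lty_mu p0 q0 _ _ _ Jf.
Qed.

(** Once [1 / (n + 1) <= t^(1/q)], an error with [q]-th power above [t] can only occur where
    [|f| > n + 1]. *)
Lemma distribution_staircase_cvg0 f (t : R) : (0 < t)%R -> J f < +oo ->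
  distribution_pow mu p q (f - mfun_staircase f n)%R t @[n --> \oo] --> 0.
Proof.
move=> t0 Jf.
have qp0 : (0 < q / p)%R by rewrite divr_gt0.
have mA n : measurable [set x | n.+1%:R < `|f x|]%R.
  have := measurable_gt_dist f 0%R n.+1%:R.
  by under eq_set do rewrite subr0.
have A0 := cvg_poweR0 qp0 (fun n => nonadditive_ge0 mu (mA n))
  (Lorentz_superlevel_cvg0 Jf).
have tq0 : (0 < t `^ q^-1)%R by rewrite powR_gt0.
apply: (squeeze_cvge _ (cvg_cst 0) A0).
near=> n; rewrite distribution_pow_ge0/=.
apply: mu_pow_le => //; first exact: measurable_gt_powR.
move=> x; rewrite /mkset sub_mfun_staircaseE => tx.
rewrite ltNge; apply/negP => fxn.
have : (`|f x - staircase n.+1%:R^-1 (n.+1 ^ 2) (f x)| <= n.+1%:R^-1)%R.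
  (* The [(n + 1)^2] levels of height [1 / (n + 1)] reach up to [n + 1]. *)
  apply: staircase_near => //; rewrite (le_trans fxn)// -[leRHS]mulr_natl.
  by rewrite ler_pdivlMr// -natrM ler_nat -mulnn ltnW.
move=> hn; move: tx; rewrite ltNge => /negP; apply.
have nt : (n.+1%:R^-1 <= t `^ q^-1)%R.
  by apply: ltW; near: n; exact: (near_infty_natSinv_lt (PosNum tq0)).
have -> : t = ((t `^ q^-1) `^ q)%R.
  by rewrite -powRrM mulVf ?gt_eqF// powRr1// ltW.
by rewrite ge0_ler_powR ?nnegrE ?(ltW q0) ?powR_ge0// (le_trans hn).
Unshelve. all: by end_near. Qed.

Lemma Lorentz_energy_staircase_cvg0 f : J f < +oo ->
  J (f - mfun_staircase f n)%R @[n --> \oo] --> 0.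
Proof.
move=> Jf.
pose D : set (measurableTypeR R) := [set` `[(0%R : R), +oo[].
have mD : measurable D by exact: measurable_itv.
have := @dominated_convergence _ _ _ (@lebesgue_measure R) D _
  (fun n => distribution_pow mu p q (f - mfun_staircase f n)%R) (cst 0)
  (distribution_pow mu p q f).
(* The distribution of [f] itself is the dominating function; its integral is [J f]. *)
have dom n t : distribution_pow mu p q (f - mfun_staircase f n)%R t <=
    distribution_pow mu p q f t.
  apply: mu_pow_le => //; [exact: measurable_gt_powR..|].
  move=> x; rewrite /mkset => tx.
  rewrite (lt_le_trans tx)// ge0_ler_powR ?nnegrE ?(ltW q0)//.
  by rewrite sub_mfun_staircaseE staircase_dist.
case=> //.
- by move=> n; apply: measurable_distribution_pow.
(* Pointwise convergence is known for [t > 0] only; the point [0] is negligible. *)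
- exists [set 0%R]; split.
  + exact: measurable_set1.
  + exact: lebesgue_measure_set1.
  + move=> t /= /not_implyP[]; rewrite /D/= in_itv/= andbT le_eqVlt.
    by move=> /predU1P[<-//|t0] []; exact: distribution_staircase_cvg0.
- apply/integrableP; split; first by apply: measurable_distribution_pow.
  under eq_integral do rewrite gee0_abs ?distribution_pow_ge0//.
  exact: Jf.
- apply: aeW => t n _; rewrite gee0_abs ?distribution_pow_ge0//.
- by move=> _ _; rewrite integral0; exact.
Qed.

End staircase_convergence.

(** * Approximation by rational steps over a sequence of sets *)

Section approximation.
Context (d : measure_display) (T : measurableType d) (R : realType).
Context (mu : nonadditive_measure T R) (p q : R).
Context (p0 : 0 < p) (q0 : 0 < q) (mu_rsub : relaxed_subadditive mu).
Context (B : (set T)^nat) (mB : forall n, measurable (B n)).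
Implicit Types (f g : {mfun T >-> R}) (l : seq (rat * nat)).
Local Notation J := (Lorentz_energy mu p q).

(** Indexing by finite lists makes the family the image of a countable type and turns concatenation
    into addition. *)
Definition rational_step l : {mfun T >-> R} :=
  \sum_(a <- l) ratr a.1 *: indic_mfun (B a.2) (mB a.2).

Definition approximable f := forall e : R, 0 < e ->
  exists l, (J (f - rational_step l)%R < e%:E)%E.

Lemma scale_indic_mfunE (c : R) (A : set T) (mA : measurable A) x :
  (c *: indic_mfun A mA) x = c * (x \in A)%:R.
Proof. by transitivity (c * \1_A x); rewrite ?indicE. Qed.

Lemma Lorentz_energy_indic_le (c : R) (A : set T) (mA : measurable A) :
  (J (c *: indic_mfun A mA)%R <= (`|c| `^ q)%:E * mu A `^ (q / p))%E.
Proof.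
apply: Lorentz_energy_bounded => // x; rewrite scale_indic_mfunE.
  by rewrite normrM ler_piMr//; case: (x \in A); rewrite ?normr1 ?normr0.
by move=> Ax; rewrite memNset// mulr0.
Qed.

Lemma Lorentz_energy_indicB_le (c : R) (A A' : set T) (mA : measurable A)
    (mA' : measurable A') :
  (J (c *: indic_mfun A mA - c *: indic_mfun A' mA')%R <=
   (`|c| `^ q)%:E * mu (A `+` A') `^ (q / p))%E.
Proof.
have E x : (c *: indic_mfun A mA - c *: indic_mfun A' mA')%R x =
    c * ((x \in A)%:R - (x \in A')%:R).
  by rewrite mulrBr -!scale_indic_mfunE.
apply: Lorentz_energy_bounded => //.
- by apply: measurableU; exact: measurableD.
- move=> x; rewrite E normrM ler_piMr//.
  by case: (x \in A); case: (x \in A');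
    rewrite ?subrr ?subr0 ?sub0r ?normrN ?normr1 ?normr0.
- move=> x nx; rewrite E.
  have [xA|xA] := boolP (x \in A); have [xA'|xA'] := boolP (x \in A');
    rewrite ?subrr ?mulr0//; exfalso; apply: nx.
    by left; split; [exact: set_mem|move/mem_set; exact/negP].
  by right; split; [exact: set_mem|move/mem_set; exact/negP].
Qed.

Lemma rational_step_lty l : (forall n, mu (B n) < +oo)%E ->
  (J (rational_step l) < +oo)%E.
Proof.
move=> By; rewrite /rational_step; elim: l => [|a l IHl].
  by rewrite big_nil Lorentz_energy0.
rewrite big_cons; apply: (Lorentz_energyD_lty p0 q0 mu_rsub _ IHl).
apply: le_lt_trans (Lorentz_energy_indic_le _ _) _.
by rewrite lte_mul_pinfty ?lee_fin ?powR_ge0// poweR_lty.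
Qed.

Lemma approximable0 : approximable 0.
Proof.
move=> e e0; exists [::].
by rewrite /rational_step big_nil subr0 Lorentz_energy0.
Qed.

Lemma approximableD f g : approximable f -> approximable g ->
  approximable (f + g).
Proof.
move=> af ag e e0; have [e' e'0 De] := Lorentz_energyD_lt p0 q0 mu_rsub e0.
have [l1 h1] := af _ e'0; have [l2 h2] := ag _ e'0.
exists (l1 ++ l2).
rewrite (_ : _ - _ = (f - rational_step l1) + (g - rational_step l2)).
  exact: De h1 h2.
by rewrite /rational_step big_cat/= opprD addrACA.
Qed.

Lemma approximable_closure f :
  (forall e : R, 0 < e -> exists2 g, approximable g & (J (f - g)%R < e%:E)%E) ->
  approximable f.
Proof.
move=> fg e e0; have [e' e'0 De] := Lorentz_energyD_lt p0 q0 mu_rsub e0.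
have [g ag Jfg] := fg _ e'0; have [l Jgl] := ag _ e'0.
exists l; rewrite (_ : _ - _ = (f - g) + (g - rational_step l)).
  exact: De Jfg Jgl.
by rewrite addrA subrK.
Qed.

Context (dense_B : forall (e : R) A, 0 < e -> measurable A ->
  (mu A < +oo)%E -> exists n, (mu (A `+` B n) < e%:E)%E).

Lemma approximable_indic (r : rat) (A : set T) (mA : measurable A) :
  (mu A < +oo)%E -> approximable (ratr r *: indic_mfun A mA).
Proof.
move=> Ay e e0; set c := (`|ratr r : R| `^ q).
have c0 : 0 <= c by rewrite powR_ge0.
(* The measure tolerance is the [p / q]-th power of [e / (c + 1)], so that the energy is at most
   [c * e / (c + 1) < e]. Adding [1] covers [c = 0]. *)
have ec0 : 0 < e / (c + 1) by rewrite divr_gt0// ltr_wpDl.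
have ep0 : 0 < (e / (c + 1)) `^ (p / q) by rewrite powR_gt0.
have [n muAB] := dense_B ep0 mA Ay.
exists [:: (r, n)]; rewrite /rational_step big_seq1/=.
apply: le_lt_trans (Lorentz_energy_indicB_le _ _ _) _; rewrite -/c.
apply: (@le_lt_trans _ _ (c%:E * (e / (c + 1))%:E)%E).
  rewrite lee_wpmul2l// ?lee_fin//.
  have -> : e / (c + 1) = ((e / (c + 1)) `^ (p / q)) `^ (q / p).
    by rewrite -powRrM mulrA divfK ?gt_eqF// divff ?gt_eqF// powRr1// ltW.
  rewrite -poweR_EFin; apply: ge0_le_poweR; last exact: ltW.
    by rewrite divr_ge0// ltW.
  by apply: nonadditive_ge0; apply: measurableU; exact: measurableD.
rewrite -EFinM lte_fin mulrA ltr_pdivrMr ?ltr_wpDl// mulrC.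
by rewrite ltr_pM2l// ltrDl.
Qed.

(** Every threshold is at least one step, hence positive, so the superlevel sets of [f] and [- f]
    involved have finite measure. *)
Lemma approximable_staircase f n : (J f < +oo)%E ->
  approximable (mfun_staircase f n).
Proof.
move=> Jf; rewrite /mfun_staircase.
elim/big_ind: _ => [||k _]; [exact: approximable0|exact: approximableD|].
have k0 : (0 : R) < n.+1%:R^-1 *+ k.+1 by rewrite pmulrn_lgt0.
have fin A : measurable A -> A `<=` [set x | n.+1%:R^-1 *+ k.+1 < `|f x|] ->
    (mu A < +oo)%E.
  move=> mA Af; apply: le_lt_trans (Lorentz_energy_lty_mu p0 q0 k0 Jf).
  apply: nonadditive_le => //.
  have := measurable_gt_dist f 0 (n.+1%:R^-1 *+ k.+1).
  by under eq_set do rewrite subr0.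
(* The step height is rational, as the coefficients of [rational_step] must be. *)
have ratE : (n.+1%:R^-1 : R) = ratr (n.+1%:R^-1 : rat)%R.
  by rewrite fmorphV rmorph_nat.
apply: approximableD; rewrite {1}ratE -?[X in X *: _]rmorphN;
  apply: approximable_indic; apply: fin; try exact: measurable_gt;
  move=> x /= /lt_le_trans; apply; first exact: ler_norm.
by rewrite -normrN ler_norm.
Qed.

Lemma approximable_Lorentz f : conditionally_order_continuous mu ->
  (J f < +oo)%E -> approximable f.
Proof.
move=> mu_coc Jf; apply: approximable_closure => e e0.
(* Convergence to [0] in the extended reals gives an index where the energy is both finite and below
   [e]. *)
have /fine_cvgP[fin] := Lorentz_energy_staircase_cvg0 p0 q0 mu_coc Jf.
move=> /cvgrPdist_lt/(_ _ e0) near_e.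
have [n [Jn Jne]] := filter_ex (filterI fin near_e).
exists (mfun_staircase f n); first exact: approximable_staircase.
move: Jne; rewrite /= sub0r normrN ger0_norm ?fine_ge0 ?Lorentz_energy_ge0//.
by rewrite -lte_fin fineK.
Qed.

End approximation.

(** * Enumeration of the basis *)

Lemma countable_basis_sequence (d : measure_display) (T : measurableType d)
    (R : realType) (mu : nonadditive_measure T R) : has_countable_basis mu ->
  exists B : (set T)^nat, [/\ forall n, measurable (B n),
    forall n, (mu (B n) < +oo)%E &
    forall (e : R) A, 0 < e -> measurable A -> (mu A < +oo)%E ->
      exists n, (mu (A `+` B n) < e%:E)%E].
Proof.
move=> [D [cD Dfin Ddense]].
(* Approximating the empty set shows that [D] is nonempty; [B0] serves as the default value at
   integers that code no member of [D]. *)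
have [B0 DB0 _] : exists2 B0, D B0 & (mu (set0 `+` B0) < 1%:E)%E.
  by apply: Ddense => //; rewrite nonadditive0.
have /countable_injP[code code_inj] := cD.
have /choice[B BP] n : exists A, D A /\ ((exists2 A', D A' & code A' = n) ->
    code A = n).
  have [[A DA An]|nA] := pselect (exists2 A', D A' & code A' = n).
    by exists A; split.
  by exists B0; split.
exists B; split=> [n|n|e A e0 mA Ay]; try by case: (BP n) => /Dfin[].
have [A' DA' AA'] := Ddense _ _ e0 mA Ay; exists (code A').
have [DB BE] := BP (code A').
(* Both sets lie in [D] and have the same code. *)
rewrite (code_inj (B (code A')) A') ?inE//; apply: BE; by exists A'.
Qed.

(** * Separability of the function space and of its quotient *)

Theorem theorem6p11 (R : realType) (d : measure_display) (T : measurableType d)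
    (T0 : [set: T] !=set0) (mu : nonadditive_measure T R) (p q : R)
    (p_gt0 : 0 < p) (q_gt0 : 0 < q)
    (mu_coc : conditionally_order_continuous mu)
    (mu_rsub : relaxed_subadditive mu)
    (mu_basis : has_countable_basis mu) :
  [/\ exists E : set {mfun T >-> R}, [/\ countable E, E `<=` Lorentz mu p q &
        forall (f : {mfun T >-> R}) (e : R), Lorentz mu p q f -> 0 < e ->
          exists2 psi, E psi & (Lorentz_norm mu p q (f - psi)%R < e%:E)%E],
      separable (Lorentz_norm mu p q) (Lorentz mu p q) &
      forall hmu : null_additive mu,
        separable (L0_norm hmu p q) (Lorentz_quotient hmu p q)].
Proof.
have [B [mB By dense_B]] := countable_basis_sequence mu_basis.
pose E := range (rational_step R mB).
have cE : countable E.
  exact: card_le_trans (card_image_le _ _) (countableP _).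
have EL : E `<=` Lorentz mu p q.
  by move=> _ [l _ <-]; apply/LorentzP => //; exact: rational_step_lty.
have Edense f e : Lorentz mu p q f -> 0 < e ->
    exists2 psi, E psi & (Lorentz_norm mu p q (f - psi)%R < e%:E)%E.
  move=> Lf e0; have [e' e'0 Je] := Lorentz_norm_lt mu p_gt0 q_gt0 e0.
  have Jf : (Lorentz_energy mu p q f < +oo)%E by apply/LorentzP.
  have [l Jl] :=
    approximable_Lorentz p_gt0 q_gt0 mu_rsub mB dense_B mu_coc Jf e'0.
  by exists (rational_step R mB l); [exists l|exact: Je].
split; [by exists E|by exists E|move=> hmu].
(* The classes of the members of [E] are dense because a difference of classes is the class of the
   difference, and its norm does not depend on the representative. *)
exists (L0_class hmu @` E); split.
- exact: card_le_trans (card_image_le _ _) cE.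
- by move=> _ [psi /EL Lpsi <-]; exists psi.
- move=> _ e [f Lf <-] e0; have [psi Epsi fpsi] := Edense f e Lf e0.
  exists (L0_class hmu psi); first by exists psi.
  by rewrite -scaleN1r L0_classZ L0_classD scaleN1r L0_norm_class.
Qed.
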